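(* Let $(\mathcal{G},\mathcal{Y},P_{G,Y})$ be a statistically degraded graph classification task: $G$ is a random input graph with values in $\mathcal{G}$, $Y$ is its label with values in $\mathcal{Y}$, $P_{G,Y}$ is their joint distribution, and $h:\mathcal{G}\to\mathcal{Y}$ is a function such that the Markov chain $G\leftrightarrow h(G)\leftrightarrow Y$ holds. Let $\gamma\in\mathbb{N}$. Then for every $\alpha>0$ there exists a (possibly randomized) explanation algorithm $\Psi_\alpha$ such that $G'\triangleq\Psi_\alpha(G)$ is an optimal solution of $$\min_{P_{G'|G}:\ \mathbb{E}(|G'|)\le\gamma}\ I(G,G')+\alpha H(Y|G'),$$ and the Markov chain $\Psi_\alpha(G)\leftrightarrow h(G)\leftrightarrow G$ holds.
   Context: All random variables are discrete; $I(\cdot,\cdot)$ is mutual information and $H(\cdot|\cdot)$ is conditional Shannon entropy. $\mathcal{G}$ is the set of possible (input) graphs and $\mathcal{Y}$ is the finite set of labels. For a graph $g$, $|g|$ denotes its number of edges. The notation $A\leftrightarrow B\leftrightarrow C$ means that $A$ and $C$ are conditionally independent given $B$. A classification task $(\mathcal{X},\mathcal{Y},P_{\mathbf{X},Y})$ with feature space $\mathcal{X}$, label set $\mathcal{Y}$ and joint distribution $P_{\mathbf{X},Y}$ is called statistically degraded if there is a function $h:\mathcal{X}\to\mathcal{Y}$ such that $\mathbf{X}\leftrightarrow h(\mathbf{X})\leftrightarrow Y$. Here $\mathbf{X}=G$. An explanation algorithm takes a graph $G$ as input and outputs a (random) graph $G'\in\mathcal{G}$. It is described by a conditional distribution $P_{G'|G}$,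 where $G'$ is generated from $G$ only, so that $Y\leftrightarrow G\leftrightarrow G'$. The minimization ranges over all such conditional distributions satisfying the expected-size constraint $\mathbb{E}(|G'|)\le\gamma$. The minimum is assumed to be attained. *)

(* Defs.v *)
From mathcomp Require Import all_boot all_order all_algebra.
From mathcomp Require Import all_classical all_reals all_analysis.

Set Implicit Arguments.
Unset Strict Implicit.
Unset Printing Implicit Defensive.

Import Order.TTheory GRing.Theory Num.Theory.

Local Open Scope classical_set_scope.
Local Open Scope ring_scope.

(* Finite graphs, loops and parallel edges allowed; undirected graphs are
   covered by forgetting the order of the endpoints. *)
Record graph := Graph {
  vertex : finType;
  edge : finType;
  endpoints : edge -> vertex * vertex }.

Definition nb_edges (g : graph) : nat := #|edge g|.

(* The support of a distribution is automatically countable, although T need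
   not be. *)
Record distr (R : realType) (T : choiceType) := Distr {
  pmf :> T -> R;
  pmf_ge0 : forall t, 0 <= pmf t;
  pmf_sum1 : \esum_(t in [set: T]) (pmf t)%:E = 1%E }.

Section discrete_random_variables.
Variables (R : realType) (Om : choiceType) (P : distr R Om).

Definition prob (E : set Om) : R := fine (\esum_(w in E) (P w)%:E).

Definition cprob (E F : set Om) : R := prob (E `&` F) / prob F.

Definition event (A : Type) (X : Om -> A) (a : A) : set Om := X @^-1` [set a].

(* Expectation of a nonnegative integer random variable; it may be +oo. *)
Definition expect (X : Om -> nat) : \bar R :=
  \esum_(w in [set: Om]) (P w * (X w)%:R)%:E.

(* X <-> Y <-> Z : X and Z are conditionally independent given Y. *)
Definition markov_chain (A B C : Type) (X : Om -> A) (Y : Om -> B)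
    (Z : Om -> C) : Prop :=
  forall a b c, prob (event Y b) != 0 ->
    cprob (event X a `&` event Z c) (event Y b) =
    cprob (event X a) (event Y b) * cprob (event Z c) (event Y b).

(* Sum of a signed family, as the difference of the sums of its positive and
   negative parts. In mutual_info the negative part has a finite sum and in
   cond_entropy it vanishes, so that oo - oo does not occur. *)
Definition signed_sum (T : choiceType) (f : T -> R) : \bar R :=
  (\esum_(t in [set: T]) (f^\+ t)%:E - \esum_(t in [set: T]) (f^\- t)%:E)%E.

(* Natural logarithms; since p = 0 multiplies the logarithm in each term, the
   convention 0 ln 0 = 0 holds. *)
Definition mutual_info (A B : choiceType) (X : Om -> A) (Y : Om -> B) : \bar R :=
  signed_sum (fun ab : A * B =>
    let p := prob (event X ab.1 `&` event Y ab.2) in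
    p * ln (p / (prob (event X ab.1) * prob (event Y ab.2)))).

(* H(X | Y) *)
Definition cond_entropy (A B : choiceType) (X : Om -> A) (Y : Om -> B) : \bar R :=
  signed_sum (fun ab : A * B =>
    - (prob (event X ab.1 `&` event Y ab.2) *
       ln (cprob (event X ab.1) (event Y ab.2)))).

End discrete_random_variables.

Lemma esumZl (R : realType) (T : choiceType) (c : R) (f : T -> \bar R) :
  0 <= c -> (forall t, 0 <= f t)%E ->
  (\esum_(t in [set: T]) (c%:E * f t) =
   c%:E * \esum_(t in [set: T]) f t)%E.
Proof.
move=> c0 f0; rewrite /esum -ereal_supZl//; last first.
  apply/set0P; exists 0%E; exists set0; first exact: fsets_set0.
  by rewrite fsbig_set0.
congr ereal_sup; apply/seteqP; split=> x /=.
  move=> [X FX <-]; exists (\sum_(t \in X) f t)%E; first by exists X.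
  by rewrite ge0_mule_fsumr.
move=> [_ [X FX <-] <-]; exists X => //.
by rewrite ge0_mule_fsumr.
Qed.

(* A conditional distribution P_{G'|G}, row g being the law of G' given G = g. *)
Definition explainer (R : realType) (Gr : choiceType) := Gr -> distr R Gr.

Section explanation.
Variables (R : realType) (Gr : choiceType) (Lab : finType).
Variables (P : distr R (Gr * Lab)%type) (Psi : explainer R Gr).

Definition joint_pmf (w : Gr * Lab * Gr) : R := P w.1 * Psi w.1.1 w.2.

Lemma joint_pmf_ge0 w : 0 <= joint_pmf w.
Proof. by apply: mulr_ge0; exact: pmf_ge0. Qed.

Lemma joint_pmf_sum1 : \esum_(w in [set: Gr * Lab * Gr]) (joint_pmf w)%:E = 1%E.
Proof.
transitivity (\esum_(gy in [set: Gr * Lab])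
    \esum_(g' in [set: Gr]) (P gy * Psi gy.1 g')%:E)%E.
  rewrite esum_esum; last first.
    by move=> gy g' _ _; rewrite lee_fin mulr_ge0// pmf_ge0.
  by congr esum; apply/seteqP; split.
rewrite -(pmf_sum1 P); apply: eq_esum => gy _.
under eq_esum do rewrite EFinM.
rewrite esumZl ?pmf_ge0// ?pmf_sum1 ?mule1// => t.
by rewrite lee_fin pmf_ge0.
Qed.

(* The law of ((G, Y), G') when G' is drawn from Psi G only, i.e. with
   Y <-> G <-> G'. *)
Definition joint : distr R (Gr * Lab * Gr)%type :=
  Distr joint_pmf_ge0 joint_pmf_sum1.

End explanation.

Section random_variables_of_the_task.
Variables (Gr : choiceType) (Lab : finType).
Definition rvG (w : Gr * Lab * Gr) : Gr := w.1.1.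
Definition rvY (w : Gr * Lab * Gr) : Lab := w.1.2.
Definition rvG' (w : Gr * Lab * Gr) : Gr := w.2.
End random_variables_of_the_task.

Section optimization.
Variables (R : realType) (Gr : choiceType) (Lab : finType).
Variables (gr : Gr -> graph) (P : distr R (Gr * Lab)%type).
Variables (gamma : nat) (alpha : R).

Definition feasible (Psi : explainer R Gr) : Prop :=
  (expect (joint P Psi) (fun w => nb_edges (gr (rvG' w))) <= gamma%:R%:E)%E.

Definition objective (Psi : explainer R Gr) : \bar R :=
  (mutual_info (joint P Psi) (@rvG Gr Lab) (@rvG' Gr Lab) +
   alpha%:E * cond_entropy (joint P Psi) (@rvY Gr Lab) (@rvG' Gr Lab))%E.

Definition optimal (Psi : explainer R Gr) : Prop :=
  feasible Psi /\
  forall Psi', feasible Psi' -> (objective Psi <= objective Psi')%E.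

End optimization.

Definition degraded_by (R : realType) (Gr : choiceType) (Lab : finType)
    (P : distr R (Gr * Lab)%type) (h : Gr -> Lab) : Prop :=
  markov_chain P (fun w => w.1) (fun w => h w.1) (fun w => w.2).

(* Main.v *)
(* Replace the explanation of [g] by a sample of the law of [G'] given
   [h(G) = h(g)].  This leaves the law of [(h(G), G')] unchanged, hence, by
   degradation, also that of [(h(G), Y, G')]; so the expected size and
   [H(Y|G')] are unchanged too, while [I(G, G')] cannot increase because [G']
   now depends on [G] through [h(G)] only. *)
Require Import Defs.
From mathcomp Require Import all_boot all_order all_algebra.
From mathcomp Require Import all_classical all_reals all_analysis.
From mathcomp Require Import ring lra.

Set Implicit Arguments.
Unset Strict Implicit.
Unset Printing Implicit Defensive.

Import Order.TTheory GRing.Theory Num.Theory.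

Local Open Scope classical_set_scope.
Local Open Scope ring_scope.

(** * Double sums of nonnegative families *)

Section esum_facts.
Variable R : realType.
Local Open Scope ereal_scope.

Lemma esum_prod (A B : choiceType) (f : A * B -> \bar R) :
  (forall ab, 0 <= f ab) ->
  \esum_(ab in [set: A * B]) f ab =
  \esum_(a in [set: A]) \esum_(b in [set: B]) f (a, b).
Proof.
move=> f0; rewrite (esum_esum (a := fun a b => f (a, b)))//.
have -> : [set: A] `*`` (fun=> [set: B]) = [set: A * B] by apply/seteqP; split.
by apply: eq_esum => -[].
Qed.

Lemma esum_exchange (A B : choiceType) (f : A -> B -> \bar R) :
  (forall a b, 0 <= f a b) ->
  \esum_(a in [set: A]) \esum_(b in [set: B]) f a b =
  \esum_(b in [set: B]) \esum_(a in [set: A]) f a b.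
Proof.
move=> f0.
rewrite -(@esum_prod _ _ (fun ab => f ab.1 ab.2))//.
rewrite -(@esum_prod _ _ (fun ba => f ba.2 ba.1))//.
apply: (@reindex_esum _ _ _ [set: B * A] _ (fun ba => (ba.2, ba.1))).
split => //.
- by move=> [? ?] [? ?] _ _ /= [-> ->].
- by move=> [a b] _; exists (b, a).
Qed.

Lemma esum_delta (A : choiceType) (a0 : A) (f : A -> R) :
  (forall a, 0 <= f a)%R ->
  \esum_(a in [set: A]) ((a0 == a)%:R * f a)%:E = (f a0)%:E.
Proof.
move=> f0; rewrite -(@esum_set1 _ _ a0 (fun a => (f a)%:E)) ?lee_fin//.
rewrite [RHS]esum_mkcond; apply: eq_esum => a _.
have [->|na] := eqVneq a0 a; first by rewrite mem_set// mul1r.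
rewrite memNset ?mul0r//= => aa0.
by rewrite aa0 eqxx in na.
Qed.

End esum_facts.

(** * Probabilities of events and laws of random variables *)

Section law.
Variables (R : realType) (Om : choiceType).
Implicit Types (P Q : distr R Om) (E F : set Om).

(** The sum over [E] is bounded by the total mass 1, so [fine] loses nothing. With an indicator all
    events are summed over the same index set. *)
Lemma prob_esum P E :
  ((prob P E)%:E = \esum_(w in [set: Om]) (P w * (w \in E)%:R)%:E)%E.
Proof.
have -> : (\esum_(w in [set: Om]) (P w * (w \in E)%:R)%:E =
    \esum_(w in E) (P w)%:E)%E.
  rewrite [RHS]esum_mkcond; apply: eq_esum => w _.
  by case: ifP; rewrite ?mulr1 ?mulr0.
rewrite /prob fineK// ge0_fin_numE; last first.
  by apply: esum_ge0 => w _; rewrite lee_fin Defs.pmf_ge0.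
rewrite esum_mkcond; apply: (@le_lt_trans _ _ 1%E); last exact: ltry.
rewrite -(pmf_sum1 P); apply: le_esum => w _.
by case: ifP => _; rewrite lee_fin ?Defs.pmf_ge0.
Qed.

Lemma prob_ge0 P E : 0 <= prob P E.
Proof.
by rewrite -lee_fin prob_esum; apply: esum_ge0 => w _; rewrite lee_fin mulr_ge0// Defs.pmf_ge0.
Qed.

Lemma le_prob P E F : E `<=` F -> prob P E <= prob P F.
Proof.
move=> EF; rewrite -lee_fin !prob_esum; apply: le_esum => w _.
rewrite lee_fin ler_wpM2l ?Defs.pmf_ge0// ler_nat.
by case: (boolP (w \in E)) => // /set_mem /EF /mem_set ->.
Qed.

Lemma prob0_le P E F : E `<=` F -> prob P F = 0 -> prob P E = 0.
Proof.
by move=> EF F0; apply/eqP; rewrite eq_le prob_ge0 andbT -F0 le_prob.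
Qed.

Lemma mem_event (A : choiceType) (X : Om -> A) a w :
  (w \in event X a) = (X w == a).
Proof. by apply/idP/eqP => [/set_mem|?]; last apply/mem_set. Qed.

(** Transfer formula: insert the indicator of [X w = a], sum over [a], and exchange the two sums. *)
Lemma esum_event (A : choiceType) P (X : Om -> A) (f : A -> R) :
  (forall a, 0 <= f a) ->
  (\esum_(w in [set: Om]) (P w * f (X w))%:E =
   \esum_(a in [set: A]) (prob P (event X a) * f a)%:E)%E.
Proof.
move=> f0.
under [RHS]eq_esum => a _.
  rewrite mulrC EFinM prob_esum -esumZl//; last first.
    by move=> w; rewrite lee_fin mulr_ge0 ?Defs.pmf_ge0.
  under eq_esum do rewrite -EFinM.
  over.
rewrite esum_exchange; last by move=> a w; rewrite lee_fin !mulr_ge0 ?Defs.pmf_ge0.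
apply: eq_esum => w _.
rewrite -(@esum_delta _ _ (X w) (fun a => P w * f a)) => [|a]; last first.
  by rewrite mulr_ge0 ?Defs.pmf_ge0.
by apply: eq_esum => a _; rewrite mem_event; congr EFin; ring.
Qed.

Lemma prob_sum1 (A : choiceType) P (X : Om -> A) :
  (\esum_(a in [set: A]) (prob P (event X a))%:E = 1)%E.
Proof.
rewrite -(pmf_sum1 P).
under eq_esum do rewrite -[prob _ _]mulr1.
rewrite -(@esum_event _ _ _ (fun=> 1))//.
by apply: eq_esum => w _; rewrite mulr1.
Qed.

Definition same_law (A : choiceType) P Q (X : Om -> A) : Prop :=
  forall a, prob P (event X a) = prob Q (event X a).

Lemma same_law_esum (A : choiceType) P Q (X : Om -> A) (f : A -> R) :
  same_law P Q X -> (forall a, 0 <= f a) ->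
  (\esum_(w in [set: Om]) (P w * f (X w))%:E =
   \esum_(w in [set: Om]) (Q w * f (X w))%:E)%E.
Proof.
by move=> PQ f0; rewrite !esum_event//; apply: eq_esum => a _; rewrite PQ.
Qed.

Lemma same_law_prob (A : choiceType) P Q (X : Om -> A) (B : set A) :
  same_law P Q X -> prob P (X @^-1` B) = prob Q (X @^-1` B).
Proof.
move=> PQ; apply/eqP; rewrite -eqe; apply/eqP; rewrite !prob_esum.
exact: (@same_law_esum _ _ _ _ (fun a => (a \in B)%:R)).
Qed.

Lemma event_pair (A B : Type) (X : Om -> A) (Y : Om -> B) a b :
  event X a `&` event Y b = event (fun w => (X w, Y w)) (a, b).
Proof. by apply/seteqP; split => w; rewrite /event /= => -[-> ->]. Qed.

End law.

(** * Mutual information decreases under coarsening *)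

Section mutual_info_coarsening.
Variable R : realType.

(** This is [ln x <= x - 1] at [x = q / p], multiplied by [p]; absolute continuity excludes
    [q = 0 < p], where the quotient would be a default value. *)
Lemma mul_ln_div_ge (p q : R) : 0 <= p -> 0 <= q -> (q = 0 -> p = 0) ->
  p - q <= p * ln (p / q).
Proof.
rewrite le_eqVlt => /predU1P[<- q0 _|p0]; first by rewrite mul0r sub0r oppr_le0.
rewrite le_eqVlt => /predU1P[<- /(_ erefl) pE|q0 _].
  by rewrite pE ltxx in p0.
have : ln (1 + (q / p - 1)) <= q / p - 1.
  by apply: le_ln1Dx; rewrite ltrBrDl subrr divr_gt0.
rewrite addrC subrK => /(ler_wpM2l (ltW p0)).
have -> : ln (p / q) = - ln (q / p) by rewrite !ln_div ?posrE// opprB.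
rewrite mulrBr mulr1 mulrCA divff ?gt_eqF// mulr1.
by lra.
Qed.

Variable Om : choiceType.
Implicit Types P Q : distr R Om.

Lemma info_term_ge (A B : choiceType) P (X : Om -> A) (Y : Om -> B) a b :
  let p := prob P (event X a `&` event Y b) in
  let q := prob P (event X a) * prob P (event Y b) in
  p - q <= p * ln (p / q).
Proof.
apply: mul_ln_div_ge; rewrite ?mulr_ge0 ?prob_ge0// => /eqP.
rewrite mulf_eq0 => /orP[] /eqP; apply: prob0_le; [exact: subIsetl|exact: subIsetr].
Qed.

Lemma info_term_neg_le (A B : choiceType) P (X : Om -> A) (Y : Om -> B) a b :
  let p := prob P (event X a `&` event Y b) in
  let q := prob P (event X a) * prob P (event Y b) in
  Num.max (- (p * ln (p / q))) 0 <= q.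
Proof.
have := @info_term_ge A B P X Y a b; cbv zeta.
have := prob_ge0 P (event X a `&` event Y b).
have q0 : 0 <= prob P (event X a) * prob P (event Y b).
  by rewrite mulr_ge0 ?prob_ge0.
by rewrite ge_max q0 andbT; lra.
Qed.

Lemma prob_mul_sum1 (A B : choiceType) P (X : Om -> A) (Y : Om -> B) :
  (\esum_(ab in [set: A * B])
     (prob P (event X ab.1) * prob P (event Y ab.2))%:E = 1)%E.
Proof.
rewrite esum_prod => [|ab]; last by rewrite lee_fin mulr_ge0 ?prob_ge0.
rewrite -(prob_sum1 P X); apply: eq_esum => a _ /=.
under eq_esum do rewrite EFinM.
by rewrite esumZl ?prob_ge0// ?prob_sum1 ?mule1// => b; rewrite lee_fin prob_ge0.
Qed.

(** The negative parts are dominated by the product of the marginals, which has total mass 1. *)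
Lemma mutual_info_neg_fin (A B : choiceType) P (X : Om -> A) (Y : Om -> B) :
  (\esum_(ab in [set: A * B])
    ((fun ab : A * B =>
      let p := prob P (event X ab.1 `&` event Y ab.2) in
      (p * ln (p / (prob P (event X ab.1) * prob P (event Y ab.2))))%R)^\- ab)%:E
   \is a fin_num)%E.
Proof.
rewrite ge0_fin_numE; last first.
  by apply: esum_ge0 => ab _; rewrite lee_fin funrneg_ge0.
apply: (@le_lt_trans _ _ 1%E); last exact: ltry.
rewrite -(prob_mul_sum1 P X Y); apply: le_esum => -[a b] _.
rewrite lee_fin; exact: info_term_neg_le.
Qed.

Lemma max_subN_max (x : R) : Num.max x 0 - Num.max (- x) 0 = x.
Proof.
have [x0|x0] := leP x 0; first by rewrite max_l ?oppr_ge0// sub0r opprK.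
by rewrite max_r ?oppr_le0 ?ltW// subr0.
Qed.

(* [Q] makes [Y] depend on [X] only through [kap X].  With [p], [p'] the joint
   laws of [(X, Y)] under [P] and [Q] and [c = ln (s / r)] the information
   density under [Q], the gap between the summands is bounded below by
   [p ln (p / p') >= p - p'], and the rest, [p c], has the same sum as [p' c]
   since [c] depends on [(kap X, Y)] only. *)
Lemma mutual_info_coarsen (A B K : choiceType) P Q (X : Om -> A) (Y : Om -> B)
    (kap : A -> K) (s : K -> B -> R) :
  same_law P Q X -> same_law P Q Y ->
  same_law P Q (fun w => (kap (X w), Y w)) ->
  (forall k b, 0 <= s k b) ->
  (forall a b, prob Q (event X a `&` event Y b) =
     prob Q (event X a) * s (kap a) b) ->
  (mutual_info Q X Y <= mutual_info P X Y)%E.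
Proof.
move=> lawX lawY lawKY s0 QE.
have := mutual_info_neg_fin P X Y; have := mutual_info_neg_fin Q X Y.
rewrite /mutual_info /signed_sum.
set fQ := fun ab : A * B => _; set fP := fun ab : A * B => _.
set FQn := (\esum_(_ in _) (fQ^\- _)%:E)%E; set FPn := (\esum_(_ in _) (fP^\- _)%:E)%E.
set FQp := (\esum_(_ in _) (fQ^\+ _)%:E)%E; set FPp := (\esum_(_ in _) (fP^\+ _)%:E)%E.
move=> FQfin FPfin.
pose pP ab := prob P (event (fun w => (X w, Y w)) ab).
pose pQ ab := prob Q (event (fun w => (X w, Y w)) ab).
pose c (kb : K * B) := ln (s kb.1 kb.2 / prob P (event Y kb.2)).
have pP0 ab : 0 <= pP ab by exact: prob_ge0.
have pQ0 ab : 0 <= pQ ab by exact: prob_ge0.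
have pQE a b : pQ (a, b) = prob P (event X a) * s (kap a) b.
  by rewrite /pQ -event_pair QE lawX.
have fQE a b : fQ (a, b) = pQ (a, b) * c (kap a, b).
  rewrite /fQ /= event_pair -/(pQ (a, b)) -lawX -lawY /c /= pQE.
  have [->|a0] := eqVneq (prob P (event X a)) 0; first by rewrite !mul0r.
  by congr (_ * ln _); rewrite -mulf_div divff// mul1r.
have fPE a b : pP (a, b) - pQ (a, b) + pP (a, b) * c (kap a, b) <= fP (a, b).
  rewrite /fP /= event_pair -/(pP (a, b)).
  have := pP0 (a, b); rewrite le_eqVlt => /predU1P[<-|p0].
    by rewrite !mul0r addr0 sub0r oppr_le0.
  have a0 : 0 < prob P (event X a).
    by apply: lt_le_trans p0 _; apply: le_prob; rewrite -event_pair; exact: subIsetl.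
  have b0 : 0 < prob P (event Y b).
    by apply: lt_le_trans p0 _; apply: le_prob; rewrite -event_pair; exact: subIsetr.
  (* If [s (kap a) b] were 0, the pair [(kap a, b)] would be null under [Q], hence under [P] by
     equality of the laws, against [0 < pP (a, b)]. *)
  have sab0 : 0 < s (kap a) b.
    rewrite lt_neqAle s0 andbT; apply/eqP => sE.
    have : pP (a, b) <= prob Q (event (fun w => (kap (X w), Y w)) (kap a, b)).
      by rewrite -lawKY; apply: le_prob => w; rewrite /event /= => -[-> ->].
    rewrite leNgt => /negP; apply; apply: le_lt_trans p0.
    rewrite -lee_fin prob_esum.
    under eq_esum do rewrite mem_event.
    rewrite (@esum_event _ _ _ _ (fun w => (X w, Y w))
      (fun ab => ((kap ab.1, ab.2) == (kap a, b))%:R))//.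
    rewrite esum1// => -[a' b'] _ /=; rewrite -/(pQ (a', b')) pQE.
    have [[-> ->]|] := eqVneq (kap a', b') (kap a, b); last by rewrite mulr0.
    by rewrite -sE mulr0 mul0r.
  have := @mul_ln_div_ge (pP (a, b)) (pQ (a, b)) (pP0 _) (pQ0 _).
  rewrite pQE => /(_ _)/wrap[|].
    by move/eqP; rewrite mulf_eq0 !gt_eqF.
  rewrite /c !ln_div ?lnM ?posrE ?mulr_gt0//=.
  by lra.
(* Nonnegative [g] keeps infinite sums meaningful; it will be the positive and the negative part. *)
have sumc (g : R -> R) : (forall x, 0 <= g x) ->
    (\esum_(ab in [set: A * B]) (pP ab * g (c (kap ab.1, ab.2)))%:E =
     \esum_(ab in [set: A * B]) (pQ ab * g (c (kap ab.1, ab.2)))%:E)%E.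
  move=> g0.
  rewrite -!(@esum_event _ _ _ _ (fun w => (X w, Y w))
    (fun ab => g (c (kap ab.1, ab.2))))//=.
  exact: (same_law_esum (f := fun kb => g (c kb)) lawKY).
have maxM (x y : R) : 0 <= x -> Num.max (x * y) 0 = x * Num.max y 0.
  by move=> x0; rewrite maxr_pMr// mulr0.
have FQpE : FQp =
    (\esum_(ab in [set: A * B]) (pP ab * Num.max (c (kap ab.1, ab.2)) 0)%:E)%E.
  rewrite (sumc (fun x => Num.max x 0)) => [|x]; last by rewrite le_max lexx orbT.
  by apply: eq_esum => -[a b] _; rewrite /funrpos fQE maxM.
have FQnE : FQn =
    (\esum_(ab in [set: A * B]) (pP ab * Num.max (- c (kap ab.1, ab.2)) 0)%:E)%E.
  rewrite (sumc (fun x => Num.max (- x) 0)) => [|x]; last by rewrite le_max lexx orbT.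
  by apply: eq_esum => -[a b] _; rewrite /funrneg fQE -mulrN maxM.
have pos (g : A * B -> R) : (forall ab, 0 <= g ab) -> 
    forall ab, [set: A * B] ab -> (0 <= (g ab)%:E)%E.
  by move=> g0 ab _; rewrite lee_fin.
have max0 (x : R) : 0 <= Num.max x 0 by rewrite le_max lexx orbT.
(* This is [fPE] summed, with every negative term moved across so that all summands are nonnegative.
   The left 1 is the mass of [pP], the right 1 that of [pQ]. *)
have key : (FPn + 1 + FQp <= FPp + 1 + FQn)%E.
  rewrite FQpE FQnE.
  rewrite -[X in (FPn + X + _)%E](prob_sum1 P (fun w => (X w, Y w))).
  rewrite -[X in (FPp + X + _)%E](prob_sum1 Q (fun w => (X w, Y w))).
  rewrite /FPn /FPp -!esumD; try by apply: pos => ab; rewrite ?addr_ge0 ?mulr_ge0 ?prob_ge0 ?max0.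
  apply: le_esum => -[a b] _; rewrite -!EFinD lee_fin.
  have := fPE a b; rewrite -/(pP (a, b)) -/(pQ (a, b)) /funrpos /funrneg /=.
  rewrite -{1}(max_subN_max (fP (a, b))) -{1}(max_subN_max (c (kap a, b))).
  by lra.
(* The negative parts are finite and cancel as reals; only the positive parts can be infinite, and
   by [key] an infinite [FQp] forces an infinite [FPp]. *)
move: key; rewrite -(fineK FQfin) -(fineK FPfin).
have FQp0 : (0 <= FQp)%E by apply: esum_ge0 => ab _; rewrite lee_fin max0.
have FPp0 : (0 <= FPp)%E by apply: esum_ge0 => ab _; rewrite lee_fin max0.
move: FQp0 FPp0; case: FQp FQpE => [x| |]; case: FPp => [y| |] //= _ _ _;
  rewrite -?EFinD ?lee_fin ?leey//.
by lra.
Qed.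

End mutual_info_coarsening.

(** * Joint laws of graph, class, label and explanation *)

Section explanation_laws.
Variables (R : realType) (Gr : choiceType) (Lab : finType).
Variables (P : distr R (Gr * Lab)%type).
Implicit Types (Psi Phi : explainer R Gr) (E : set (Gr * Lab)).

(** The rows of [Psi] sum to 1, so the law of [(G, Y)] is the same for every explainer. *)
Lemma prob_joint Psi E :
  prob (joint P Psi) [set w | E w.1] = prob P E.
Proof.
apply/eqP; rewrite -eqe; apply/eqP; rewrite !prob_esum.
rewrite esum_prod => [|w]; last by rewrite lee_fin mulr_ge0// Defs.pmf_ge0.
apply: eq_esum => gy _ /=.
rewrite -[RHS]mule1 -(pmf_sum1 (Psi gy.1)) -esumZl; last 2 first.
- by rewrite mulr_ge0 ?Defs.pmf_ge0.
- by move=> g'; rewrite lee_fin Defs.pmf_ge0.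
by apply: eq_esum => g' _; rewrite -EFinM mulrAC.
Qed.

Lemma prob_joint_explanation Psi E g' :
  ((prob (joint P Psi) ([set w | E w.1] `&` event (@rvG' Gr Lab) g'))%:E =
   \esum_(gy in [set: Gr * Lab]) (P gy * ((gy \in E)%:R * Psi gy.1 g'))%:E)%E.
Proof.
rewrite prob_esum esum_prod => [|w]; last first.
  by rewrite lee_fin mulr_ge0// Defs.pmf_ge0.
apply: eq_esum => gy _ /=.
rewrite -(@esum_delta _ _ g' (fun x => P gy * ((gy \in E)%:R * Psi gy.1 x))).
  apply: eq_esum => x _; rewrite in_setI mem_event eq_sym -mulnb natrM.
  rewrite /joint_pmf /=; have -> : ((gy, x) \in [set w | E w.1]) = (gy \in E) by [].
  by congr EFin; ring.
by move=> x; rewrite !mulr_ge0 ?Defs.pmf_ge0.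
Qed.

Lemma prob_graph_explanation Psi g g' :
  prob (joint P Psi) (event (@rvG Gr Lab) g `&` event (@rvG' Gr Lab) g') =
  prob P (event fst g) * Psi g g'.
Proof.
apply/eqP; rewrite -eqe; apply/eqP.
rewrite (@prob_joint_explanation Psi (event fst g) g').
rewrite mulrC EFinM prob_esum -esumZl ?Defs.pmf_ge0//; last first.
  by move=> gy; rewrite lee_fin mulr_ge0 ?Defs.pmf_ge0.
apply: eq_esum => gy _; rewrite -EFinM mem_event.
by have [->|_] := eqVneq gy.1 g; rewrite /= ?mulr1n ?mulr0n; congr EFin; ring.
Qed.

Variable h : Gr -> Lab.

Lemma prob_class Psi k : prob (joint P Psi) (event (fun w => h (rvG w)) k) =
  prob P (event (fun gy => h gy.1) k).
Proof. exact: (@prob_joint Psi (event (fun gy => h gy.1) k)). Qed.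

Lemma prob_class_explanation Psi k g' :
  ((prob (joint P Psi)
     (event (fun w => h (rvG w)) k `&` event (@rvG' Gr Lab) g'))%:E =
   \esum_(g in [set: Gr])
     (prob P (event fst g) * ((h g == k)%:R * Psi g g'))%:E)%E.
Proof.
rewrite (@prob_joint_explanation Psi (event (fun gy => h gy.1) k) g').
under eq_esum do rewrite mem_event.
rewrite (@esum_event _ _ _ _ fst (fun g => (h g == k)%:R * Psi g g'))// => g.
by rewrite mulr_ge0 ?Defs.pmf_ge0.
Qed.

Hypothesis h_degraded : degraded_by P h.

(** Fixing [G = g] also fixes the class [h g], so in the Markov identity the class mass cancels on
    both sides. If the class is null, both sides vanish. *)
Lemma degraded_pmf g y :
  P (g, y) = prob P (event fst g) *
    cprob P (event snd y) (event (fun gy => h gy.1) (h g)).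
Proof.
have -> : P (g, y) = prob P (event fst g `&` event snd y).
  apply/eqP; rewrite -eqe; apply/eqP; rewrite prob_esum.
  rewrite -(@esum_delta _ _ (g, y) P); last exact: Defs.pmf_ge0.
  by apply: eq_esum => -[g1 y1] _; rewrite event_pair mem_event eq_sym mulrC.
have sub : event fst g `<=` event (fun gy : Gr * Lab => h gy.1) (h g).
  by move=> gy; rewrite /event /= => ->.
have [pi0|pi0] := eqVneq (prob P (event (fun gy => h gy.1) (h g))) 0.
  rewrite (prob0_le (P := P) sub pi0) mul0r.
  by apply: prob0_le pi0; apply: subset_trans sub; exact: subIsetl.
have := h_degraded g y pi0; rewrite {1 2}/cprob.
rewrite setIAC (setIidl sub) mulrAC => /(mulIf _) -> //.
by rewrite invr_neq0.
Qed.

(** By degradation the conditional law of the label is constant on the class [k] and comes out of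
    the sum over its graphs. The remaining label factor does not involve [Psi]. *)
Lemma prob_class_label_explanation Psi k y g' :
  prob (joint P Psi)
    (event (fun w => (h (rvG w), rvY w, rvG' w)) (k, y, g')) =
  cprob P (event snd y) (event (fun gy => h gy.1) k) *
  prob (joint P Psi)
    (event (fun w => h (rvG w)) k `&` event (@rvG' Gr Lab) g').
Proof.
apply/eqP; rewrite -eqe EFinM prob_class_explanation -esumZl; last 2 first.
- by rewrite divr_ge0 ?prob_ge0.
- by move=> g; rewrite lee_fin !mulr_ge0 ?prob_ge0 ?Defs.pmf_ge0.
rewrite -event_pair
  (@prob_joint_explanation Psi (event (fun gy => (h gy.1, gy.2)) (k, y)) g').
rewrite esum_prod => [|gy]; last by rewrite lee_fin !mulr_ge0 ?Defs.pmf_ge0.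
apply/eqP; apply: eq_esum => g _; rewrite -EFinM.
under eq_esum => y' _.
  rewrite mem_event (_ : P _ * _ =
    (y == y')%:R * (P (g, y') * ((h g == k)%:R * Psi g g'))); last first.
    rewrite /= (_ : _ == (k, y) = (h g == k) && (y == y')).
      by rewrite -mulnb natrM; ring.
    by rewrite (eq_sym y).
  over.
rewrite (@esum_delta _ _ y (fun y' => P (g, y') * ((h g == k)%:R * Psi g g'))).
  rewrite degraded_pmf; have [->|_] := eqVneq (h g) k; rewrite /= ?mulr1n ?mulr0n; congr EFin; ring.
by move=> y'; rewrite !mulr_ge0 ?Defs.pmf_ge0.
Qed.

Lemma same_law_explanation Psi Phi :
  same_law (joint P Psi) (joint P Phi) (fun w => (h (rvG w), rvG' w)) ->
  same_law (joint P Psi) (joint P Phi)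
    (fun w => (h (rvG w), rvY w, rvG' w)).
Proof.
move=> law [[k y] g'].
by rewrite !prob_class_label_explanation !event_pair law.
Qed.

End explanation_laws.

(** * The explainer averaged over the classes of [h] *)

Section averaging.
Variables (R : realType) (Gr : choiceType) (Lab : finType).
Variables (P : distr R (Gr * Lab)%type) (h : Gr -> Lab) (Psi : explainer R Gr).

Definition class_law (k : Lab) (g' : Gr) : R :=
  cprob (joint P Psi) (event (@rvG' Gr Lab) g')
    (event (fun w => h (rvG w)) k).

(* On null classes the conditional law is a junk value, not a distribution. *)
Definition average_pmf (g g' : Gr) : R :=
  if prob P (event (fun gy => h gy.1) (h g)) == 0 then Psi g g'
  else class_law (h g) g'.

Lemma class_law_ge0 k g' : 0 <= class_law k g'.
Proof. by rewrite divr_ge0 ?prob_ge0. Qed.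

Lemma average_pmf_ge0 g g' : 0 <= average_pmf g g'.
Proof.
by rewrite /average_pmf; case: ifP => _; [exact: Defs.pmf_ge0|exact: class_law_ge0].
Qed.

Lemma average_pmf_sum1 g : (\esum_(g' in [set: Gr]) (average_pmf g g')%:E = 1)%E.
Proof.
have [pi0|pi0] := eqVneq (prob P (event (fun gy => h gy.1) (h g))) 0.
  rewrite -(pmf_sum1 (Psi g)); apply: eq_esum => g' _.
  by rewrite /average_pmf pi0 eqxx.
under eq_esum => g' _.
  rewrite /average_pmf (negbTE pi0) /class_law /cprob prob_class mulrC EFinM.
  over.
rewrite esumZl ?invr_ge0 ?prob_ge0//; last first.
  by move=> g'; rewrite lee_fin prob_ge0.
suff -> : (\esum_(g' in [set: Gr])
    (prob (joint P Psi) (event (@rvG' Gr Lab) g' `&`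
      event (fun w => h (rvG w)) (h g)))%:E =
    (prob P (event (fun gy => h gy.1) (h g)))%:E)%E.
  by rewrite -EFinM mulVf.
rewrite -(prob_class P h Psi (h g)) prob_esum.
under [RHS]eq_esum do rewrite mem_event.
(* Passing to the pair [(G', h(G))] splits the mass of the class by the value of [G']. *)
rewrite (@esum_event _ _ _ _ (fun w => (rvG' w, h (rvG w)))
  (fun x => (x.2 == h g)%:R))//.
rewrite esum_prod => [|x]; last by rewrite lee_fin mulr_ge0 ?prob_ge0.
apply: eq_esum => g' _ /=.
rewrite -(@esum_delta _ _ (h g) (fun k => prob (joint P Psi)
  (event (@rvG' Gr Lab) g' `&` event (fun w => h (rvG w)) k))).
  by apply: eq_esum => k _; rewrite event_pair eq_sym mulrC.
by move=> k; exact: prob_ge0.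
Qed.

Definition average : explainer R Gr :=
  fun g => Distr (average_pmf_ge0 g) (average_pmf_sum1 g).

(** The case distinction in [average_pmf] disappears here: a graph in a null class has mass 0,
    whatever its row. *)
Lemma prob_graph_average g g' :
  prob (joint P average) (event (@rvG Gr Lab) g `&` event (@rvG' Gr Lab) g') =
  prob P (event fst g) * class_law (h g) g'.
Proof.
rewrite prob_graph_explanation /= /average_pmf; case: ifPn => // /eqP pi0.
rewrite (prob0_le (P := P) _ pi0) ?mul0r//.
by move=> gy; rewrite /event /= => ->.
Qed.

Lemma prob_class_average k g' :
  prob (joint P average)
    (event (fun w => h (rvG w)) k `&` event (@rvG' Gr Lab) g') =
  prob P (event (fun gy => h gy.1) k) * class_law k g'.
Proof.
apply/eqP; rewrite -eqe mulrC EFinM prob_class_explanation prob_esum.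
under [X in (_ * X)%E]eq_esum do rewrite mem_event.
rewrite (@esum_event _ _ _ _ fst (fun g => (h g == k)%:R))//.
rewrite -esumZl ?class_law_ge0//; last first.
  by move=> g; rewrite lee_fin mulr_ge0 ?prob_ge0.
apply/eqP; apply: eq_esum => g _; rewrite mulrCA -prob_graph_explanation
  prob_graph_average -EFinM.
by have [->|_] := eqVneq (h g) k; rewrite /= ?mulr1n ?mulr0n; congr EFin; ring.
Qed.

(** The class mass times the conditional law gives back the joint law; on a null class both sides
    are 0. *)
Lemma same_law_average :
  same_law (joint P Psi) (joint P average) (fun w => (h (rvG w), rvG' w)).
Proof.
move=> [k g']; rewrite -!event_pair prob_class_average.
rewrite /class_law /cprob prob_class.
have [pi0|pi0] := eqVneq (prob P (event (fun gy => h gy.1) k)) 0; last first.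
  by rewrite mulrCA divff// mulr1 setIC.
rewrite pi0 mul0r.
by apply: (prob0_le (subIsetl (B := _))); rewrite prob_class.
Qed.

Lemma markov_chain_average :
  markov_chain (joint P average) (@rvG' Gr Lab) (fun w => h (rvG w))
    (@rvG Gr Lab).
Proof.
(* If [g] lies outside the class [k], the events are disjoint and both sides are 0. *)
move=> g' k g; have [<-|hgk] := eqVneq (h g) k; last first.
  have dis : event (@rvG Gr Lab) g `&` event (fun w => h (rvG w)) k = set0.
    rewrite -subset0 => w []; rewrite /event /= => -> /eqP.
    by rewrite (negbTE hgk).
  have prob0 : prob (joint P average) set0 = 0 by rewrite /prob esum_set0.
  by rewrite /cprob -setIA dis setI0 prob0 !mul0r mulr0.
have sub : event (@rvG Gr Lab) g `<=` event (fun w => h (rvG w)) (h g).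
  by move=> w; rewrite /event /= => ->.
rewrite /cprob -setIA (setIidl sub) setIC prob_graph_average.
rewrite [X in prob _ X / _ * _]setIC prob_class_average prob_class => pi0.
rewrite (@prob_joint _ _ _ P average (event fst g)).
by field.
Qed.

End averaging.

(** * Invariance of the conditional entropy, and the conclusion *)

(** The entropy depends only on the law of [(X, Y)], a marginal of the triple; [Z] is carried along
    to receive the class [h(G)]. *)
Lemma same_law_cond_entropy (R : realType) (Om A B C : choiceType)
    (P Q : distr R Om) (X : Om -> A) (Y : Om -> B) (Z : Om -> C) :
  same_law P Q (fun w => (Z w, X w, Y w)) ->
  cond_entropy P X Y = cond_entropy Q X Y.
Proof.
move=> law; congr signed_sum; apply/funext => -[a b] /=.
rewrite /cprob.
have -> : prob P (event X a `&` event Y b) = prob Q (event X a `&` event Y b).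
  exact: (same_law_prob [set z | z.1.2 = a /\ z.2 = b] law).
have -> // : prob P (event Y b) = prob Q (event Y b).
exact: (same_law_prob [set z | z.2 = b] law).
Qed.

(* Gr indexes the set of possible graphs, gr g being the graph denoted by g;
   gr need not be injective, so that graphs may carry further data such as node
   features. *)
Theorem theorem1 (R : realType) (Gr : choiceType) (gr : Gr -> graph)
    (Lab : finType) (P : distr R (Gr * Lab)%type) (h : Gr -> Lab)
    (h_degraded : degraded_by P h) (gamma : nat) (alpha : R)
    (alpha_gt0 : 0 < alpha)
    (min_attained : exists Psi : explainer R Gr, optimal gr P gamma alpha Psi) :
  exists Psi : explainer R Gr,
    optimal gr P gamma alpha Psi /\
    markov_chain (joint P Psi) (@rvG' Gr Lab) (fun w => h (rvG w))
      (@rvG Gr Lab).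
Proof.
have [Psi [feas opt]] := min_attained.
exists (average P h Psi); split; last exact: markov_chain_average.
have law := same_law_average P h Psi.
(* Degradation adds the label to the preserved law, as [H(Y|G')] requires. *)
have law3 := same_law_explanation h_degraded law.
split.
  rewrite /feasible /expect.
  rewrite -(same_law_esum (f := fun x => (nb_edges (gr x.2))%:R) law)//.
move=> Psi' /opt; apply: le_trans; rewrite /objective.
rewrite (same_law_cond_entropy law3); apply: leeD2r.
(* Under the averaged explainer, [G'] given [G = g] has law [class_law P h Psi (h g)] whenever [g]
   has positive mass, which is the required kernel through [h]. *)
apply: (mutual_info_coarsen (kap := h) (s := class_law P h Psi)) => //.
- move=> g; transitivity (prob P (event fst g)); last symmetry;
    exact: (@prob_joint _ _ _ P _ (event fst g)).
- by move=> g'; exact: (same_law_prob [set z | z.2 = g'] law).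
- exact: class_law_ge0.
- move=> g g'; rewrite prob_graph_average; congr (_ * _); symmetry.
  exact: (@prob_joint _ _ _ P _ (event fst g)).
Qed.
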